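(* Let $p$ be a prime, $n\ge 1$, $q=p^n$. Let $L\in\mathbb{F}_q[x]$ be a monic $p$-linearized polynomial that divides $x^q-x$, set $p^{n-k}=\deg(L)$ and $U_L=\{z\in\overline{\mathbb{F}}_q : L(z)=0\}$. Let $f,M\in\mathbb{F}_q[x]$ with $M$ a $p$-linearized polynomial, and let $P(x)=f(L(x))+M(x)\in\mathbb{F}_q[x]$. Then the size of the value set $V_P$ of $P$ over $\mathbb{F}_q$ satisfies $$|V_P|=c\cdot\frac{p^{n-k}}{\deg(\gcd(L,M))},$$ where $c$ is the number of distinct cosets of the $\mathbb{F}_p$-vector space $M(U_L)$ represented by the elements $P(a)$, as $a$ runs over a set of representatives of $\mathbb{F}_q/U_L$ (that is, the number of distinct cosets of the form $P(a)+M(U_L)$).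
   Context: A $p$-linearized polynomial is a polynomial of the form $\sum_{i=0}^m a_i x^{p^i}$ (the zero polynomial is allowed). The value set of $P$ over $\mathbb{F}_q$ is $V_P=\{P(y): y\in\mathbb{F}_q\}$. Since $L$ divides $x^q-x$, $U_L$ is an $\mathbb{F}_p$-subspace of $\mathbb{F}_q$. *)

(* Defs.v *)
From HB Require Import structures.
From mathcomp Require Import all_boot all_order all_algebra.
From mathcomp Require Import all_classical.

Set Implicit Arguments.
Unset Strict Implicit.
Unset Printing Implicit Defensive.

Import GRing.Theory.

Local Open Scope classical_set_scope.
Local Open Scope ring_scope.

(* The zero polynomial is allowed: take all a i = 0. *)
Definition linearized (F : fieldType) (p : nat) (A : {poly F}) : Prop :=
  exists (m : nat) (a : 'I_m.+1 -> F), A = \sum_(i < m.+1) a i *: 'X^(p ^ i).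

Definition deg (F : fieldType) (A : {poly F}) : nat := (size A).-1.

Definition value_set (F : finFieldType) (A : {poly F}) : {set F} :=
  [set A.[y] | y in [set: F]]%SET.

(* (K, iota) is an algebraic closure of F; integrality over a field is
   algebraicity. *)
Definition is_alg_closure (F : fieldType) (K : closedFieldType)
    (iota : {rmorphism F -> K}) : Prop := integralRange iota.

Section AlgebraicClosure.

Variables (F : fieldType) (K : closedFieldType) (iota : {rmorphism F -> K}).

Definition zeros (A : {poly F}) : set K := [set z | root (map_poly iota A) z].

Definition poly_image (A : {poly F}) (U : set K) : set K :=
  [set (map_poly iota A).[u] | u in U].

Definition translate (b : F) (W : set K) : set K := [set iota b + w | w in W].

(* R contains exactly one element of each class of F modulo U, where U is a
   subgroup of K contained in the image of F. *)
Definition representatives (U : set K) (R : set F) : Prop :=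
  forall a : F, exists! r : F, R r /\ U (iota (a - r)).

Definition represented_cosets (P : {poly F}) (W : set K) (R : set F) :
    set (set K) :=
  [set translate P.[a] W | a in R].

End AlgebraicClosure.

(* Main.v *)
Require Import Defs.
From HB Require Import structures.
From mathcomp Require Import all_boot all_order all_algebra.
From mathcomp Require Import finfield.
From mathcomp Require Import all_classical.

(** If [u] is a root of [L], then [L.[a + u] = L.[a]], since [L] is additive;
    hence [f \Po L] does not see the translation by [u], and
    [P.[a + u] = P.[a] + M.[u]].  Two consequences: the value set of [P] is
    stable under translation by the additive group [S] of the values of [M] on
    the roots of [L], and the coset [P.[a] + S] depends only on the class of
    [a] modulo those roots.  So the value set is a disjoint union of cosets of
    [S], which are exactly the [c] cosets of the theorem, and its size is
    [c * #|S|] ([card_union_cosets]).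

    To compute [#|S|], view [M] as a group morphism on the roots of [L]: the
    size of its image is the number of roots of [L] divided by the number of
    common roots of [L] and [M] ([card_additive_image]), which are the roots of
    [gcdp L M].  Both [L] and [gcdp L M] divide ['X^#|F| - 'X], so they split
    over [F] into distinct linear factors, and each has as many roots in [F] as
    its degree ([card_root_set]).  For the same reason the zeros of [L] in the
    algebraic closure all come from [F] ([zeros_root_set]), so that the counting
    takes place inside [F] and is transported along [iota]. *)

Set Implicit Arguments.
Unset Strict Implicit.
Unset Printing Implicit Defensive.

Import GRing.Theory.

Local Open Scope ring_scope.

(** * Divisors of X^q - X and linearized polynomials *)

Definition root_set (F : finFieldType) (A : {poly F}) : {set F} :=
  [set x | root A x]%SET.

(** The polynomial ['X^#|F| - 'X] is the product of all ['X - x%:P]; each of its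
    divisors is, up to a unit, the product over a subset of these factors, and
    a factor occurs in it exactly when [x] is a root. *)
Lemma eqp_prod_root_set (F : finFieldType) (A : {poly F}) :
  A %| 'X^#|F| - 'X -> A %= \prod_(x in root_set A) ('X - x%:P).
Proof.
rewrite finField_genPoly => /dvdp_prod_XsubC [m].
set s := mask m _ => eqAs.
have s_uniq : uniq s by apply: mask_uniq; apply: index_enum_uniq.
have s_roots : s =i root_set A.
  by move=> x; rewrite inE (eqp_root eqAs) root_prod_XsubC.
have -> : \prod_(x in root_set A) ('X - x%:P) = \prod_(x <- s) ('X - x%:P).
  rewrite -big_enum; apply/perm_big/uniq_perm => //; first exact: enum_uniq.
  by move=> x; rewrite mem_enum s_roots.
exact: eqAs.
Qed.

Lemma card_root_set (F : finFieldType) (A : {poly F}) :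
  A %| 'X^#|F| - 'X -> #|root_set A| = deg A.
Proof.
move=> /eqp_prod_root_set/eqp_size; rewrite /deg -big_enum size_prod_XsubC => ->.
by rewrite -cardE.
Qed.

Lemma root_set_gcdp (F : finFieldType) (A B : {poly F}) :
  root_set (gcdp A B) = [set x in root_set A | B.[x] == 0]%SET.
Proof. by apply/setP => x; rewrite !inE root_gcd. Qed.

(** Each monomial ['X^(p ^ i)] is a power of the Frobenius morphism. *)
Lemma linearized_hornerB (F : fieldType) (p : nat) (A : {poly F}) :
  p \in [pchar F] -> linearized p A -> {morph horner A : x y / x - y}.
Proof.
move=> charFp [m [a ->]] x y.
rewrite !horner_sum -sumrB; apply: eq_bigr => i _.
rewrite !hornerZ !hornerXn -mulrBr; congr (_ * _).
have charN : ([pchar F].-nat (p ^ i))%N.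
  by rewrite pnatX pnatE ?(pcharf_prime charFp) ?charFp.
by apply/eqP; rewrite eq_sym subr_eq -exprDn_pchar // subrK.
Qed.

(** * Counting with additive subgroups *)

Section AdditiveGroups.

Variables V W : finZmodType.

(** Image times kernel: the fibre of [h] over [h v] is the translate by [v] of
    the kernel of [h] on [U], so all fibres have the same size. *)
Lemma card_additive_image (h : {additive V -> W}) (U : {set V}) :
  zmod_closed U ->
  #|U| = (#|[set h u | u in U]%SET| * #|[set u in U | h u == 0%R]%SET|)%N.
Proof.
move=> [U0 UB]; have UD u v : u \in U -> v \in U -> u + v \in U.
  by move=> Uu Uv; rewrite -[v]opprK -[- v]sub0r !UB.
rewrite -sum1_card (partition_big_imset h) /= -sum_nat_const.
apply: eq_bigr => _ /imsetP [v Uv ->].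
rewrite sum1dep_card -[RHS](card_imset _ (addrI v)); apply: eq_card => u.
rewrite !inE; apply/andP/imsetP => [[Uu /eqP huv]|[t]].
  exists (u - v); last by rewrite [RHS]addrC subrK.
  by rewrite inE UB //= raddfB huv subrr eqxx.
by rewrite inE => /andP [Ut /eqP ht0] ->; rewrite UD // raddfD ht0 addr0 eqxx.
Qed.

Definition coset (b : V) (S : {set V}) : {set V} := [set b + w | w in S]%SET.

Variable S : {set V}.
Hypothesis S_group : zmod_closed S.

Lemma mem_coset (x b : V) : (x \in coset b S) = (x - b \in S).
Proof.
apply/imsetP/idP => [[w Sw ->]|Sxb]; first by rewrite addrC addKr.
by exists (x - b); rewrite // addrC subrK.
Qed.

Lemma coset_eq (x b : V) : x - b \in S -> coset x S = coset b S.
Proof.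
case: S_group => S0 SB Sxb; apply/setP => y; rewrite !mem_coset.
have -> : y - x = (y - b) - (x - b) by rewrite opprB addrA subrK.
apply/idP/idP => [Sy|Sy]; last exact: SB.
by rewrite -[y - b](subrK (x - b)) -[X in _ + X]opprK SB // -sub0r SB.
Qed.

(** Stability under [S] makes [D] the union of the cosets of its elements; two
    cosets that meet are equal, and each has the size of [S]. *)
Lemma card_union_cosets (D : {set V}) :
  (forall b w, b \in D -> w \in S -> b + w \in D) ->
  #|D| = (#|[set coset b S | b in D]%SET| * #|S|)%N.
Proof.
move=> D_stable; have coset_refl b : b \in coset b S.
  by rewrite mem_coset subrr; case: S_group.
apply: card_uniform_partition.
  by move=> _ /imsetP [b _ ->]; rewrite card_imset //; apply: addrI.
apply/and3P; split.
- apply/eqP/setP => x; apply/bigcupP/idP => [[_ /imsetP [b Db ->]]|Dx].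
    by case/imsetP => w Sw ->; apply: D_stable.
  by exists (coset x S); [apply: imset_f|apply: coset_refl].
- apply/finset.trivIsetP => _ _ /imsetP [a _ ->] /imsetP [b _ ->]; apply: contraR.
  case/pred0Pn => x /=; rewrite !mem_coset => /andP [/coset_eq <-].
  by move=> /coset_eq ->.
- by apply/negP => /imsetP [b _ b0]; have := coset_refl b; rewrite -b0 inE.
Qed.

End AdditiveGroups.

Local Open Scope classical_set_scope.
Local Open Scope card_scope.

(** * Transfer to the algebraic closure *)

Section Transfer.

Variables (F : finFieldType) (K : closedFieldType) (iota : {rmorphism F -> K}).

(** [A] already splits over [F], so its image under [iota] acquires no root
    outside the image of [F]. *)
Lemma zeros_root_set (A : {poly F}) :
  A %| 'X^#|F| - 'X -> zeros iota A = iota @` [set` root_set A].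
Proof.
move=> /eqp_prod_root_set eqA; apply/seteqP; split => [z|_ [x /= Ax <-]].
  rewrite /zeros /= -(eqp_map iota) in eqA *.
  rewrite (eqp_root eqA) rmorph_prod /= -big_enum /= => /[dup] zA.
  under eq_bigr do rewrite map_polyXsubC.
  rewrite -(big_map iota predT (fun y => 'X - y%:P)) root_prod_XsubC.
  by case/mapP => x; rewrite mem_enum => Ax ->; exists x.
by rewrite /zeros /= fmorph_root; rewrite inE in Ax.
Qed.

Lemma poly_image_iota (A : {poly F}) (U : {set F}) :
  poly_image iota A (iota @` [set` U]) =
  iota @` [set` [set A.[u] | u in U]%SET].
Proof.
apply/seteqP; split => [_ [_ [u /= Uu <-] <-]|_ [_ /imsetP [u Uu ->] <-]].
  by exists A.[u]; [apply: imset_f|rewrite horner_map].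
by exists (iota u); [exists u|rewrite horner_map].
Qed.

Lemma translate_iota (b : F) (S : {set F}) :
  translate iota b (iota @` [set` S]) = iota @` [set` coset b S].
Proof.
apply/seteqP; split => [_ [_ [w /= Sw <-] <-]|_ [_ /imsetP [w Sw ->] <-]].
  by exists (b + w); [apply: imset_f|rewrite rmorphD].
by exists (iota w); [exists w|rewrite rmorphD].
Qed.

Lemma iota_image_inj : injective (fun S : {set F} => iota @` [set` S]).
Proof.
move=> S T /= eqST; apply/setP => x.
have mem_iota_image (Q : {set F}) : (iota @` [set` Q]) (iota x) <-> x \in Q.
  by split=> [[y Qy /fmorph_inj <-] //|Qx]; exists x.
by apply/idP/idP => /mem_iota_image;
  [rewrite eqST|rewrite -eqST] => /mem_iota_image.
Qed.

End Transfer.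

(** Passes from equipotence with [`I_c], which is how the number of cosets is
    given, to the cardinal of a finite set. *)
Lemma card_image_eqII (T : finType) (U : Type) (g : T -> U) (A : {set T})
    (c : nat) :
  injective g -> g @` [set` A] #= `I_c -> #|A| = c.
Proof.
move=> g_inj Ac; apply/esym/card_eq_II; rewrite -(card_eql Ac) card_eq_sym.
have -> : g @` [set` A] = (g \o enum_val) @` [set: 'I_#|A|].
  apply/seteqP; split => [_ [x /= Ax <-]|_ [i _ <-]].
    by exists (enum_rank_in Ax x); rewrite //= enum_rankK_in.
  by exists (enum_val i) => //; apply: enum_valP.
rewrite card_eq_sym (card_eqr card_II); apply: inj_card_eq => i j _ _.
by move=> /g_inj /enum_val_inj.
Qed.

(** * The size of the value set *)

Theorem theorem4p4 (p n : nat) (F : finFieldType)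
  (K : closedFieldType) (iota : {rmorphism F -> K})
  (L f M P : {poly F}) (k : nat) (R : set F) (c : nat)
  (hp : prime p) (hn : (1 <= n)%N) (hq : #|F| = (p ^ n)%N)
  (hK : is_alg_closure iota)
  (hLmonic : L \is monic) (hLlin : linearized p L)
  (hLdvd : L %| 'X^(p ^ n) - 'X)
  (hk : (k <= n)%N) (hdegL : deg L = (p ^ (n - k))%N)
  (hMlin : linearized p M)
  (hP : P = f \Po L + M)
  (hR : representatives iota (zeros iota L) R)
  (hc : represented_cosets iota P (poly_image iota M (zeros iota L)) R
        #= `I_c) :
  #|value_set P|%:R = c%:R * ((p ^ (n - k))%:R / (deg (gcdp L M))%:R) :> rat.
Proof.
have charFp : p \in [pchar F] by apply: card_finPcharP hq hp.
have LB := linearized_hornerB charFp hLlin.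
have MB := linearized_hornerB charFp hMlin.
pose Madd := GRing.isZmodMorphism.Build F F (horner M) MB.
pose h : {additive F -> F} := HB.pack (horner M) Madd.
rewrite -hq in hLdvd; set U := root_set L.
have inU x : (x \in U) = (L.[x] == 0) by rewrite inE.
have U_group : zmod_closed U.
  have UB : {in U &, forall x y, x - y \in U}.
    by move=> x y; rewrite !inU LB => /eqP -> /eqP ->; rewrite subrr.
  by split=> //; rewrite inU -[X in L.[X]](subrr 0) LB subrr.
pose S := [set M.[u] | u in U]%SET.
have S_group : zmod_closed S.
  case: U_group => U0 UB; split.
    by apply/imsetP; exists 0; last exact: (esym (raddf0 h)).
  by move=> _ _ /imsetP [u Uu ->] /imsetP [v Uv ->]; rewrite -MB imset_f ?UB.
have cardU : #|U| = (#|S| * deg (gcdp L M))%N.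
  rewrite (card_additive_image h U_group).
  by rewrite -root_set_gcdp card_root_set // (dvdp_trans (dvdp_gcdl _ _)).
(* The two occurrences of [f \Po L] cancel, since [L] agrees at [a] and [b]. *)
have P_shift a b : a - b \in U -> P.[a] - P.[b] = M.[a - b].
  rewrite inU LB subr_eq0 => /eqP Lab.
  by rewrite hP !hornerD !horner_comp Lab opprD addrACA subrr add0r MB.
(* [R] meets every class modulo the zeros of [L], so the cosets represented by
   [R] are those of all the values of [P]. *)
have cosetsE : represented_cosets iota P (poly_image iota M (zeros iota L)) R =
    (fun Q : {set F} => iota @` [set` Q]) @`
      [set` [set coset b S | b in value_set P]%SET].
  rewrite zeros_root_set // poly_image_iota; apply/seteqP; split.
    move=> _ [a _ <-]; exists (coset P.[a] S); rewrite ?translate_iota //.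
    by apply/imset_f/imset_f.
  move=> _ [_ /imsetP [_ /imsetP [a _ ->] ->] <-].
  have [r [[Rr Uar] _]] := hR a; exists r => //; rewrite translate_iota.
  have Uar' : a - r \in U by move: Uar; rewrite /zeros /= fmorph_root inE.
  have SPar : P.[a] - P.[r] \in S by rewrite P_shift // imset_f.
  by rewrite (coset_eq S_group SPar).
have cardC : #|[set coset b S | b in value_set P]%SET| = c.
  by apply: (card_image_eqII (@iota_image_inj _ _ iota)); rewrite -cosetsE.
have cardP : #|value_set P| = (c * #|S|)%N.
  rewrite (card_union_cosets S_group (D := value_set P)) ?cardC //.
  move=> _ _ /imsetP [a _ ->] /imsetP [u Uu ->]; apply/imsetP.
  exists (a + u) => //; have := P_shift (a + u) a.
  by rewrite addrAC subrr add0r => /(_ Uu) <-; rewrite addrC subrK.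
have deg_gcd_neq0 : (deg (gcdp L M))%:R != 0 :> rat.
  rewrite Num.Theory.pnatr_eq0; apply/eqP => deg0.
  have: (0 < p ^ (n - k))%N by rewrite expn_gt0 prime_gt0.
  by rewrite -hdegL -card_root_set // cardU deg0 muln0.
rewrite cardP natrM -hdegL -card_root_set // cardU natrM.
by rewrite mulfK.
Qed.
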